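(* Let $R$ be a commutative ring with unity, let $G$ be a finite group whose order is invertible in $R$, and let $\sigma,\tau$ be $R$-algebra endomorphisms of $RG$ which are $R$-linear extensions of group endomorphisms of $G$. Let $C_1,\dots,C_r$ be all the distinct $(\sigma,\tau)$-conjugacy classes of $G$, with representatives $x_1,\dots,x_r$ respectively. Then every $(\sigma,\tau)$-derivation of $RG$ is inner, that is, $\mathcal{D}_{(\sigma,\tau)}(RG)=\mathrm{Inn}_{(\sigma,\tau)}(RG)$. Furthermore, if $s$ is a positive integer such that $|C_i|=1$ for all $i\in\{1,\dots,s\}$ and $|C_i|\ge2$ for all $i\in\{s+1,\dots,r\}$, then the set $$\mathcal{B}_0=\left\{D_g\;\middle|\; g\in\bigcup_{i=s+1}^r(C_i\setminus\{x_i\})\right\}$$ is an $R$-basis of $\mathcal{D}_{(\sigma,\tau)}(RG)$.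
   Context: A $(\sigma,\tau)$-derivation of $RG$ is an $R$-linear map $D: RG\to RG$ with $D(\alpha\beta)=D(\alpha)\tau(\beta)+\sigma(\alpha)D(\beta)$ for all $\alpha,\beta\in RG$; $\mathcal{D}_{(\sigma,\tau)}(RG)$ is the $R$-module of all of them. For $\beta\in RG$, $D_\beta(\alpha)=\beta\tau(\alpha)-\sigma(\alpha)\beta$; the maps $D_\beta$ are the inner $(\sigma,\tau)$-derivations and $\mathrm{Inn}_{(\sigma,\tau)}(RG)$ is the $R$-module of all of them. For $x\in G$, the $(\sigma,\tau)$-conjugacy class of $x$ in $G$ is $\{\sigma(g)x\tau(g)^{-1}\mid g\in G\}$; these classes partition $G$. *)

(* Defs.v *)
From HB Require Import structures.
From mathcomp Require Import all_boot all_order all_algebra all_fingroup.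
From mathcomp Require Import boolp classical_sets functions.

Set Implicit Arguments.
Unset Strict Implicit.
Unset Printing Implicit Defensive.

Import GRing.Theory.

Local Open Scope ring_scope.

(* [comPzRingType] rather than [comNzRingType], so that the zero ring is
   allowed; this is why algebra morphisms below are linear monoid morphisms
   instead of [{lrmorphism _ -> _}], which requires nonzero rings. *)
Definition groupRing (R : comPzRingType) (gT : finGroupType) : Type :=
  {ffun gT -> R^o}.

Section GroupRing.
Variables (R : comPzRingType) (gT : finGroupType).
Local Notation RG := (groupRing R gT).
Implicit Types (a b c : RG) (g h k : gT).

HB.instance Definition _ := GRing.Lmodule.copy RG {ffun gT -> R^o}.

(* The image of [g] under the canonical map from [gT] to its group ring. *)
Definition gr_elt g : RG := [ffun h => (h == g)%:R].

Definition gr_mul a b : RG := [ffun g => \sum_h (a h : R) * b (h^-1 * g)%g].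

Fact gr_mulA : associative gr_mul.
Proof.
move=> a b c; apply/ffunP => g; rewrite !ffunE.
under eq_bigr => h _ do rewrite ffunE mulr_sumr.
under [RHS]eq_bigr => h _ do rewrite ffunE mulr_suml.
rewrite [RHS]exchange_big; apply: eq_bigr => h _ /=.
rewrite [RHS](reindex_inj (mulgI h)); apply: eq_bigr => k _ /=.
by rewrite mulrA mulKg invMg mulgA.
Qed.

Fact gr_mul1l : left_id (gr_elt 1%g) gr_mul.
Proof.
move=> a; apply/ffunP => g; rewrite ffunE (bigD1 1%g) //= ffunE eqxx mul1r.
by rewrite invg1 mul1g big1 ?addr0 // => h /negPf h1; rewrite ffunE h1 mul0r.
Qed.

Fact gr_mul1r : right_id (gr_elt 1%g) gr_mul.
Proof.
move=> a; apply/ffunP => g; rewrite ffunE (bigD1 g) //= ffunE mulVg eqxx mulr1.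
rewrite big1 ?addr0 // => h /negPf hg; rewrite ffunE.
by rewrite -(inj_eq (mulgI h)) mulKVg mulg1 eq_sym hg mulr0.
Qed.

Fact gr_mulDl : left_distributive gr_mul +%R.
Proof.
move=> a b c; apply/ffunP => g; rewrite !ffunE -big_split.
by apply: eq_bigr => h _; rewrite ffunE mulrDl.
Qed.

Fact gr_mulDr : right_distributive gr_mul +%R.
Proof.
move=> a b c; apply/ffunP => g; rewrite !ffunE -big_split.
by apply: eq_bigr => h _; rewrite ffunE mulrDr.
Qed.

HB.instance Definition _ := GRing.Zmodule_isPzRing.Build RG
  gr_mulA gr_mul1l gr_mul1r gr_mulDl gr_mulDr.

Lemma groupRing_scalerAl (r : R) a b : r *: (a * b) = (r *: a) * b.
Proof.
apply/ffunP => g; rewrite !ffunE [LHS]mulr_sumr.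
by apply: eq_bigr => h _; rewrite ffunE -mulrA.
Qed.

Lemma groupRing_scalerAr (r : R) a b : r *: (a * b) = a * (r *: b).
Proof.
apply/ffunP => g; rewrite !ffunE [LHS]mulr_sumr.
by apply: eq_bigr => h _; rewrite ffunE mulrCA.
Qed.

Lemma groupRing_mulE a b g : (a * b) g = \sum_h (a h : R) * b (h^-1 * g)%g.
Proof. by rewrite ffunE. Qed.

Lemma gr_elt1 : gr_elt 1%g = 1. Proof. by []. Qed.

Lemma gr_eltM g h : gr_elt (g * h)%g = gr_elt g * gr_elt h.
Proof.
apply/ffunP => k; rewrite !ffunE (bigD1 g) //= !ffunE eqxx mul1r.
rewrite -(inj_eq (mulgI g) (g^-1 * k)%g) mulKVg big1 ?addr0 //.
by move=> l /negPf lg; rewrite ffunE lg mul0r.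
Qed.

Lemma groupRing_sumE a : a = \sum_g (a g : R) *: gr_elt g.
Proof.
apply/ffunP => h; rewrite sum_ffunE (bigD1 h) //= !ffunE eqxx [_ *: _]mulr1.
rewrite big1 ?addr0 // => g /negPf gh; rewrite !ffunE eq_sym gh.
exact: mulr0.
Qed.

Definition algebra_endo (f : RG -> RG) : Prop :=
  linear f /\ GRing.monoid_morphism f.

Definition extends_group_endo (phi : {multiplicative gT -> gT})
    (f : RG -> RG) : Prop :=
  linear f /\ forall g, f (gr_elt g) = gr_elt (phi g).

Section Derivations.
Variables sigma tau : RG -> RG.

Definition derivations : set (RG -> RG) :=
  [set D : RG -> RG | linear D /\
    forall a b, D (a * b) = D a * tau b + sigma a * D b]%classic.

Definition inner_der b : RG -> RG := fun a => b * tau a - sigma a * b.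

Definition inner_derivations : set (RG -> RG) :=
  [set inner_der b | b in [set: RG]]%classic.

Lemma derivations0 : derivations 0.
Proof.
split=> [r a b|a b]; rewrite /GRing.zero /=.
  by rewrite scaler0 addr0.
by rewrite mul0r mulr0 addr0.
Qed.

Lemma derivations_lin (r : R) (D E : RG -> RG) :
  derivations D -> derivations E -> derivations (r *: D + E).
Proof.
have vE (x : RG) : (r *: D + E) x = r *: D x + E x by [].
move=> [Dl DM] [El EM]; split=> [s a b|a b]; rewrite !vE.
  rewrite Dl El !scalerDr !scalerA mulrC -!addrA; congr (_ + _).
  by rewrite addrCA.
rewrite DM EM scalerDr mulrDl mulrDr groupRing_scalerAl groupRing_scalerAr.
by rewrite addrACA.
Qed.

End Derivations.
End GroupRing.

Definition twisted_class (gT : finGroupType)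
    (phi psi : {multiplicative gT -> gT}) (x : gT) : {set gT} :=
  [set (phi g * x * (psi g)^-1)%g | g : gT]%SET.

Definition twisted_classes (gT : finGroupType)
    (phi psi : {multiplicative gT -> gT}) : {set {set gT}} :=
  [set twisted_class phi psi x | x : gT]%SET.

(* [N] is meant to be a submodule of [M], so that the first two clauses say
   that the span of [B] is exactly [N].  [B] is a plain subset, not an indexed
   family, hence [uniq s] in the clause on linear independence. *)
Definition is_basis (R : pzRingType) (M : lmodType R) (N B : set M) : Prop :=
  [/\ (B `<=` N)%classic,
      forall v : M, N v ->
        exists (s : seq M) (c : M -> R),
          (forall b, b \in s -> B b) /\ v = \sum_(b <- s) c b *: b
    & forall (s : seq M) (c : M -> R),
        uniq s -> (forall b, b \in s -> B b) ->
        \sum_(b <- s) c b *: b = 0 -> forall b, b \in s -> c b = 0].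

(* Main.v *)
Require Import Defs.
From HB Require Import structures.
From mathcomp Require Import all_boot all_order all_algebra all_fingroup.
From mathcomp Require Import boolp classical_sets functions.

(** Everything rests on two facts about [inner_der sigma tau], which is linear
    in the element defining it.

    It is surjective onto the derivations because the order of the group is
    invertible: the twisted form of the averaging argument that kills the first
    cohomology of the group produces an element [b] defining [D], namely the
    mean of [D g * tau g^-1] over the group ([derivation_inner]).

    Its kernel is the module of functions that are constant on the twisted
    conjugacy classes ([inner_der_eq0]).  Hence the derivations are the quotient
    of the group ring by that module.  Subtracting from [b] the class function
    that agrees with it on a transversal of the classes shows that each coset
    has exactly one element vanishing on the transversal, so the group elements
    outside the transversal give a basis ([derivations_basis]).  A class with
    one element is contained in every transversal, which is why the basis of the
    theorem involves only the larger classes. *)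

Set Implicit Arguments.
Unset Strict Implicit.
Unset Printing Implicit Defensive.

Import GRing.Theory.

Local Open Scope ring_scope.

(** A basis is a plain set of vectors, whereas derivations come indexed by group
    elements; this lemma is the passage from families to sets.  Over the zero
    ring [F] is constant, so the passage must allow repetitions: coefficients of
    equal vectors are added up, and conversely each vector of a linear relation
    is charged to a single index. *)
Lemma is_basis_family (R : pzRingType) (M : lmodType R) (I : finType)
    (N : set M) (A : {set I}) (F : I -> M) :
    (forall i, i \in A -> N (F i)) ->
    (forall v, N v -> exists k : I -> R, v = \sum_(i in A) k i *: F i) ->
    (forall k : I -> R, \sum_(i in A) k i *: F i = 0 ->
       forall i, i \in A -> k i = 0) ->
  is_basis N [set F i | i in [set i | i \in A]]%classic.
Proof.
move=> FN span free; split.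
- by move=> _ [i /= Ai <-]; exact: FN.
- move=> v /span[k ->].
  exists (undup [seq F i | i in A]), (fun b => \sum_(i in A | F i == b) k i).
  split=> [b|].
    by rewrite mem_undup => /fintype.imageP[i Ai ->]; exists i.
  under [RHS]eq_bigr => b _ do rewrite scaler_suml big_mkcondr /=.
  rewrite [RHS]exchange_big /=; apply: eq_bigr => i Ai.
  have Fi : F i \in undup [seq F i | i in A].
    by rewrite mem_undup fintype.image_f.
  rewrite (bigD1_seq (F i)) ?undup_uniq //= eqxx big1 ?addr0 // => b.
  by rewrite eq_sym => /negPf ->.
- move=> s c s_uniq sB s0 b0 b0s.
  have [h hP] : exists h : M -> I,
      forall b, b \in s -> h b \in A /\ F (h b) = b.
    have [i0 _ _] := sB b0 b0s.
    exists (fun b => odflt i0 [pick i in A | F i == b]) => b bs.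
    case: pickP => [i /andP[Ai /eqP] //|none].
    by have [i /= Ai Fi] := sB b bs; have := none i; rewrite Ai Fi eqxx.
  have [hA Fh] := hP b0 b0s.
  pose k i := \sum_(b <- s | h b == i) c b.
  have -> : c b0 = k (h b0).
    rewrite /k big_mkcond (bigD1_seq b0) //= eqxx big1_seq ?addr0 // => b.
    case/andP=> b_neq bs; case: eqP => // hb.
    by rewrite -(hP b bs).2 hb Fh eqxx in b_neq.
  apply: free hA; rewrite -[RHS]s0.
  under eq_bigr => i _ do rewrite scaler_suml big_mkcond /=.
  rewrite exchange_big /=; apply: eq_big_seq => b bs.
  have [hbA Fhb] := hP b bs.
  rewrite (bigD1 (h b)) //= eqxx Fhb big1 ?addr0 // => i /andP[_].
  by rewrite eq_sym => /negPf ->.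
Qed.

Lemma group_endo1 (gT : finGroupType) (phi : {multiplicative gT -> gT}) :
  phi 1%g = 1%g.
Proof. by apply: (mulgI (phi 1%g)); rewrite -gmulfM !mulg1. Qed.

Lemma group_endoV (gT : finGroupType) (phi : {multiplicative gT -> gT}) g :
  phi g^-1%g = (phi g)^-1%g.
Proof. by apply: (mulgI (phi g)); rewrite -gmulfM !mulgV group_endo1. Qed.

Section TwistedClasses.
Variables (gT : finGroupType) (phi psi : {multiplicative gT -> gT}).
Implicit Types g h y : gT.

Lemma twisted_class_refl y : y \in twisted_class phi psi y.
Proof.
by apply/imsetP; exists 1%g; rewrite // !group_endo1 invg1 mulg1 mul1g.
Qed.

Lemma twisted_class_sub y g :
  g \in twisted_class phi psi y ->
  twisted_class phi psi g \subset twisted_class phi psi y.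
Proof.
case/imsetP=> h _ ->; apply/fintype.subsetP => _ /imsetP[k _ ->].
by apply/imsetP; exists (k * h)%g => //; rewrite !gmulfM invMg !mulgA.
Qed.

Lemma twisted_class_sym y g :
  g \in twisted_class phi psi y -> y \in twisted_class phi psi g.
Proof.
case/imsetP=> h _ ->; apply/imsetP; exists h^-1%g => //.
by rewrite !group_endoV invgK !mulgA mulVg mul1g mulgKV.
Qed.

Lemma twisted_class_eq y g :
  g \in twisted_class phi psi y ->
  twisted_class phi psi g = twisted_class phi psi y.
Proof.
move=> gy; apply/eqP; rewrite finset.eqEsubset twisted_class_sub //.
exact/twisted_class_sub/twisted_class_sym.
Qed.

End TwistedClasses.

Section TwistedDerivations.
Variables (R : comPzRingType) (gT : finGroupType).
Local Notation RG := (groupRing R gT).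
Local Notation elt := (gr_elt R).
Implicit Types (a b : RG) (g h y : gT).

Lemma groupRing_mulr_elt b h y : (b * elt h) y = b (y * h^-1)%g.
Proof.
rewrite groupRing_mulE (bigD1 (y * h^-1)%g) //= ffunE.
rewrite invMg invgK mulgKV eqxx mulr1 big1 ?addr0 // => k /negPf kN.
rewrite ffunE -(inj_eq (mulgI k)) mulKVg.
by rewrite -(inj_eq (mulIg h^-1%g)) mulgK eq_sym kN mulr0.
Qed.

Lemma groupRing_mull_elt b h y : (elt h * b) y = b (h^-1 * y)%g.
Proof.
rewrite groupRing_mulE (bigD1 h) //= ffunE eqxx mul1r big1 ?addr0 // => k.
by move=> /negPf kN; rewrite ffunE kN mul0r.
Qed.

Lemma linear_groupRing_eq (D E : RG -> RG) :
  linear D -> linear E -> (forall g, D (elt g) = E (elt g)) -> D = E.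
Proof.
move=> Dl El DE; apply/funext => a.
pose D' := HB.pack_for {linear RG -> RG} D (GRing.isLinear.Build _ _ _ _ D Dl).
pose E' := HB.pack_for {linear RG -> RG} E (GRing.isLinear.Build _ _ _ _ E El).
rewrite (groupRing_sumE a) -[D]/(D' : _ -> _) -[E]/(E' : _ -> _) !linear_sum.
by apply: eq_bigr => g _; rewrite !linearZ; congr (_ *: _); apply: DE.
Qed.

Section InnerDer.
Variables sigma tau : RG -> RG.

Lemma inner_der_is_linear : linear (inner_der sigma tau).
Proof.
move=> r b c; apply/funext => a.
rewrite -[RHS]/(r *: inner_der sigma tau b a + inner_der sigma tau c a).
rewrite /inner_der mulrDl mulrDr -groupRing_scalerAl -groupRing_scalerAr.
by rewrite opprD addrACA -scalerBr.
Qed.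

HB.instance Definition _ := GRing.isLinear.Build R RG (RG -> RG) _
  (inner_der sigma tau) inner_der_is_linear.

Hypotheses (sigma_endo : algebra_endo sigma) (tau_endo : algebra_endo tau).

Lemma inner_derivation b : derivations sigma tau (inner_der sigma tau b).
Proof.
have [sl [_ sM]] := sigma_endo; have [tl [_ tM]] := tau_endo.
rewrite /inner_der; split=> [r a c|a c].
  rewrite sl tl mulrDl mulrDr -groupRing_scalerAl -groupRing_scalerAr.
  by rewrite opprD addrACA -scalerBr.
by rewrite sM tM mulrBl mulrBr !mulrA addrA subrK.
Qed.

Variables phi psi : {multiplicative gT -> gT}.
Hypotheses (sigma_ext : extends_group_endo phi sigma)
  (tau_ext : extends_group_endo psi tau).

(** Evaluated at a group element [h], the identity [b * tau h = sigma h * b]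
    compares the coefficient of [b] at [g] with that at its twisted conjugate
    by [h]; group elements suffice by linearity. *)
Lemma inner_der_eq0 b :
  inner_der sigma tau b = 0 <->
  forall h g, b (phi h * g * (psi h)^-1)%g = b g.
Proof.
split=> [Db0 h g|b_class].
  have /subr0_eq := congr1 (fun D : RG -> RG => D (elt h)) Db0.
  rewrite sigma_ext.2 tau_ext.2 => /ffunP/(_ (phi h * g)%g).
  by rewrite groupRing_mulr_elt groupRing_mull_elt mulKg.
apply: linear_groupRing_eq => [||h]; first by case: (inner_derivation b).
  by move=> r a c; rewrite scaler0 addr0.
rewrite /inner_der sigma_ext.2 tau_ext.2; apply/eqP; rewrite subr_eq0.
apply/eqP/ffunP => y; rewrite groupRing_mulr_elt groupRing_mull_elt.
by rewrite -[RHS](b_class h) mulKVg.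
Qed.

(** Multiplying [sigma h * D g = D (h * g) - D h * tau g] by [tau g^-1] and
    averaging over [g] gives [sigma h * b = b * tau h - D h]. *)
Lemma derivation_inner (u : R) (D : RG -> RG) :
  #|gT|%:R * u = 1 -> derivations sigma tau D ->
  D = inner_der sigma tau (u *: \sum_g D (elt g) * tau (elt g^-1%g)).
Proof.
move=> u_inv [Dl DM]; set b := u *: _.
have tM g h : tau (elt g) * tau (elt h) = tau (elt (g * h)%g).
  by rewrite gr_eltM tau_endo.2.2.
apply: linear_groupRing_eq => // [|h]; first by case: (inner_derivation b).
suff Db : sigma (elt h) * b = b * tau (elt h) - D (elt h).
  by rewrite /inner_der Db opprB addrC subrK.
rewrite /b -groupRing_scalerAr -groupRing_scalerAl mulr_sumr mulr_suml.
have -> : D (elt h) = u *: \sum_(g : gT) D (elt h).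
  by rewrite sumr_const -scaler_nat scalerA mulrC u_inv scale1r.
rewrite -scalerBr; congr (_ *: _).
rewrite [X in _ = X - _](reindex_inj (mulgI h)) -sumrB /=.
apply: eq_bigr => g _; rewrite -mulrA tM invMg mulgKV.
rewrite gr_eltM DM mulrDl -!mulrA tM mulgV.
by rewrite gr_elt1 tau_endo.2.1 mulr1 [RHS]addrC addKr.
Qed.

Lemma derivations_inner (u : R) :
  #|gT|%:R * u = 1 ->
  derivations sigma tau = inner_derivations sigma tau.
Proof.
move=> u_inv; apply/seteqP; split=> [D DD|_ [b _ <-]].
  by rewrite (derivation_inner u_inv DD); eexists.
exact: inner_derivation.
Qed.

(** The map [rho] picks the representative of each twisted class, so its fixed
    points form a transversal.  Spanning: [b] and [b] minus the class function
    [b \o rho] define the same derivation, and the latter is supported on [A].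
    Independence: an element supported on [A] that defines the zero derivation
    is a class function vanishing on the transversal. *)
Theorem derivations_basis (u : R) (rho : gT -> gT) (A : {set gT}) :
    #|gT|%:R * u = 1 ->
    (forall h g, rho (phi h * g * (psi h)^-1)%g = rho g) ->
    (forall g, rho g \in twisted_class phi psi g) ->
    (forall g, (g \in A) = (g != rho g)) ->
  is_basis (derivations sigma tau)
    [set inner_der sigma tau (elt g) | g in [set g | g \in A]]%classic.
Proof.
move=> u_inv rho_class rho_mem AE.
have sum_rho (k : gT -> R) :
    (forall g, g \notin A -> k g = 0) ->
  \sum_(g in A) k g *: inner_der sigma tau (elt g) =
  inner_der sigma tau [ffun g => k g].
  move=> k0; rewrite (groupRing_sumE [ffun g => k g]) linear_sum.
  rewrite [RHS](bigID [in A]) /= [X in _ + X]big1 ?addr0.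
    by apply: eq_bigr => g _; rewrite linearZ ffunE.
  by move=> g gA; rewrite ffunE k0 // scale0r linear0.
apply: is_basis_family => [g _|v|k].
- exact: inner_derivation.
- move=> vD; rewrite (derivation_inner u_inv vD); move: (_ *: _) => b.
  exists (fun g => (b g : R) - b (rho g)).
  rewrite sum_rho => [|g]; last by rewrite AE negbK => /eqP <-; rewrite subrr.
  apply/eqP; rewrite -subr_eq0 -linearB; apply/eqP.
  by apply/inner_der_eq0 => h g; rewrite !ffunE rho_class !subKr.
- (* Only the coefficients on [A] matter, so [k] is first cut down to [A]. *)
  pose k' g := if g \in A then k g else 0.
  rewrite (eq_bigr (fun g => k' g *: inner_der sigma tau (elt g))); last first.
    by move=> g gA; rewrite /k' gA.
  rewrite sum_rho => [/inner_der_eq0 k_class g gA|g /negPf gA]; last first.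
    by rewrite /k' gA.
  have -> : k g = k' g by rewrite /k' gA.
  have /imsetP[h _ rho_g] := rho_mem g.
  have := k_class h g; rewrite !ffunE -rho_g => <-.
  by rewrite /k' AE {2}rho_g rho_class eqxx.
Qed.

End InnerDer.
End TwistedDerivations.

Theorem corollary4p18 (R : comPzRingType) (gT : finGroupType)
    (order_inv : exists u : R, #|gT|%:R * u = 1)
    (phi psi : {multiplicative gT -> gT})
    (sigma tau : groupRing R gT -> groupRing R gT)
    (sigma_endo : algebra_endo sigma) (tau_endo : algebra_endo tau)
    (sigma_ext : extends_group_endo phi sigma)
    (tau_ext : extends_group_endo psi tau)
    (r : nat) (C : 'I_r -> {set gT}) (x : 'I_r -> gT)
    (C_inj : injective C)
    (C_all : [set C i | i : 'I_r]%SET = twisted_classes phi psi)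
    (x_rep : forall i : 'I_r, x i \in C i) :
  derivations sigma tau = inner_derivations sigma tau /\
  forall s : nat, (0 < s)%N -> (s <= r)%N ->
    (forall i : 'I_r, (i < s)%N -> #|C i| = 1%N) ->
    (forall i : 'I_r, (s <= i)%N -> (2 <= #|C i|)%N) ->
    is_basis (derivations sigma tau)
      [set inner_der sigma tau (gr_elt R g) | g in
        [set g | g \in (\bigcup_(i < r | (s <= i)%N) (C i :\ x i))%SET]]%classic.
Proof.
have [u u_inv] := order_inv; split; first exact: derivations_inner u_inv.
move=> s _ _ C_small C_large.
have C_class i g : g \in C i -> C i = twisted_class phi psi g.
  have : C i \in twisted_classes phi psi by rewrite -C_all imset_f.
  by case/imsetP=> y _ -> /twisted_class_eq.
have C_idx g i j : g \in C i -> g \in C j -> i = j.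
  by move=> /C_class Ci /C_class Cj; apply: C_inj; rewrite Ci Cj.
have C_cover g : exists i, g \in C i.
  have : twisted_class phi psi g \in twisted_classes phi psi by rewrite imset_f.
  rewrite -C_all => /imsetP[i _ gE]; exists i.
  by rewrite -gE twisted_class_refl.
pose idx g := xchoose (C_cover g).
have idxP g : g \in C (idx g) := xchooseP (C_cover g).
apply: (derivations_basis sigma_endo tau_endo sigma_ext tau_ext
  (rho := fun g => x (idx g)) u_inv) => [h g|g|g].
- congr x; apply: (C_idx (phi h * g * (psi h)^-1)%g) => //.
  by rewrite (C_class _ _ (idxP g)); apply/imsetP; exists h.
- by rewrite -(C_class _ _ (idxP g)).
- apply/bigcupP/idP => [[i _ /setD1P[gx gC]]|gx].
    by rewrite (C_idx g (idx g) i).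
  exists (idx g); last by rewrite !inE gx idxP.
  (* A class of index below [s] is a singleton, hence reduced to its
     representative. *)
  rewrite leqNgt; apply: contra gx => /C_small/eqP/cards1P[y CE].
  have := idxP g; have := x_rep (idx g); rewrite CE !inE => /eqP -> /eqP <-.
  by [].
Qed.
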